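(* Suppose the basic assumptions (i)–(vi) listed in the context hold, that the pair $(f_1,h)$ is $L$-smad on $C$ for some $L>0$, and that $\mathcal{T}_{\lambda'}(x)\subset C$ for all $x\in C$ and all $\lambda'>0$. Suppose moreover that: (a) $\operatorname{dom} h=\mathbb{R}^d$ and $h$ is $\sigma$-strongly convex on $\mathbb{R}^d$ (for some $\sigma>0$); (b) $\nabla h$ and $\nabla f_1$ are Lipschitz continuous on any bounded subset of $\mathbb{R}^d$; (c) $\Psi$ is level-bounded, i.e., for every $r\in\mathbb{R}$ the set $\{x\in\mathbb{R}^d\mid \Psi(x)\le r\}$ is bounded; (d) $f_2$ is continuously differentiable on an open set $\mathcal{N}_0\subset\mathbb{R}^d$ that contains the set $\mathcal{X}$ of all limiting critical points of $(\mathcal{P})$, and $\nabla f_2$ is locally Lipschitz continuous on $\mathcal{N}_0$; (e) $\Psi$ is a KL function. Let $\{x^k\}_{k=0}^\infty$ be a sequence generated by BPDCA with $0<\lambda L<1$. Then: (i) $\lim_{k\to\infty}\operatorname{dist}(0,\partial\Psi(x^k))=0$; (ii) the sequence $\{x^k\}_{k=0}^\infty$ converges to a limiting stationary point of $(\mathcal{P})$; moreover, $\sum_{k=1}^\infty\|x^k-x^{k-1}\|<\infty$.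
   Context: $\|\cdot\|$ is the Euclidean norm, $C\subset\mathbb{R}^d$ is a nonempty, convex, open set, $\overline{C}$ its closure. For convex $f$, $\partial_{\mathrm c}f(x)=\{\xi\in\mathbb{R}^d\mid f(y)-f(x)-\langle\xi,y-x\rangle\ge 0\ \forall y\in\mathbb{R}^d\}$. Limiting subdifferential: for proper lower semicontinuous $f$ and $x\in\operatorname{dom} f$, $\partial f(x)$ is the set of $\xi\in\mathbb{R}^d$ for which there exist $x^k\to x$ with $f(x^k)\to f(x)$ and $\xi^k\to\xi$ such that $\liminf_{y\to x^k,\,y\ne x^k}\frac{f(y)-f(x^k)-\langle\xi^k,y-x^k\rangle}{\|y-x^k\|}\ge 0$ for each $k$. Kernel generating distance: $h\in\mathcal{G}(C)$ means $h:\mathbb{R}^d\to(-\infty,+\infty]$ is proper, lower semicontinuous and convex, $\operatorname{dom} h\subset\overline{C}$, $\operatorname{dom}\partial h=C$, and $h$ is $\mathcal{C}^1$ on $\operatorname{int}\operatorname{dom} h=C$. Bregman distance: $D_h(x,y)=h(x)-h(y)-\langle\nabla h(y),x-y\rangle$ for $x\in\operatorname{dom} h$, $y\in C$. $L$-smad: $(f,h)$ is $L$-smooth adaptable ($L$-smad) on $C$, $L>0$, if $h\in\mathcal{G}(C)$, $f:\mathbb{R}^d\to(-\infty,+\infty]$ is proper and lower semicontinuous with $\operatorname{dom} h\subset\operatorname{dom} f$ and $\mathcal{C}^1$ on $C$, and $Lh-f$ and $Lh+f$ are convex on $C$. Problem $(\mathcal{P})$: minimize $\Psi(x)=f_1(x)-f_2(x)+g(x)$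 over $x\in\overline{C}$. Basic assumptions: (i) $h\in\mathcal{G}(C)$ with $\overline{C}=\overline{\operatorname{dom} h}$; (ii) $f_1:\mathbb{R}^d\to(-\infty,+\infty]$ is proper and convex with $\operatorname{dom} h\subset\operatorname{dom}(f_1+g)$, and $\mathcal{C}^1$ on $C$; (iii) $f_2:\mathbb{R}^d\to(-\infty,+\infty]$ is proper and convex; (iv) $g:\mathbb{R}^d\to(-\infty,+\infty]$ is proper and lower semicontinuous with $\operatorname{dom} g\cap C\neq\emptyset$; (v) $v(\mathcal{P}):=\inf\{\Psi(x)\mid x\in\overline{C}\}>-\infty$; (vi) for any $\lambda>0$, $\lambda g+h$ is supercoercive: $\lim_{\|u\|\to\infty}\frac{\lambda g(u)+h(u)}{\|u\|}=\infty$. For $x\in C$, $\xi\in\partial_{\mathrm c}f_2(x)$, $\lambda>0$: $\mathcal{T}_\lambda(x):=\operatorname{argmin}_{u\in\overline{C}}\{g(u)+\langle\nabla f_1(x)-\xi,u-x\rangle+\frac1\lambda D_h(u,x)\}$. BPDCA: choose $x^0\in C$ and $0<\lambda<1/L$; for $k=0,1,2,\dots$ take any $\xi^k\in\partial_{\mathrm c}f_2(x^k)$ and let $x^{k+1}$ be a minimizer over $x\in\overline{C}$ of $g(x)+\langle\nabla f_1(x^k)-\xi^k,x-x^k\rangle+\frac1\lambda D_h(x,x^k)$. When $C=\mathbb{R}^d$: $\tilde x$ is a limiting critical point of $(\mathcal{P})$ if $0\in\nabla f_1(\tilde x)-\partial_{\mathrm c}f_2(\tilde x)+\partial g(\tilde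 x)$ (the set of these is $\mathcal{X}$), and a limiting stationary point if $0\in\partial\Psi(\tilde x)$. KL property: for $\eta>0$, $\Xi_\eta$ is the set of continuous concave $\phi:[0,\eta)\to\mathbb{R}_+$, $\mathcal{C}^1$ on $(0,\eta)$ with positive derivative, $\phi(0)=0$. A proper lower semicontinuous $f$ has the KL property at $\hat x\in\operatorname{dom}\partial f$ if there are $\eta\in(0,+\infty]$, a neighborhood $U$ of $\hat x$ and $\phi\in\Xi_\eta$ with $\phi'(f(x)-f(\hat x))\cdot\operatorname{dist}(0,\partial f(x))\ge 1$ for all $x\in U$ with $f(\hat x)<f(x)<f(\hat x)+\eta$. $f$ is a KL function if it has the KL property at each point of $\operatorname{dom}\partial f$. *)

(* Defs.v *)
From HB Require Import structures.
From mathcomp Require Import all_boot all_order all_algebra.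
From mathcomp Require Import all_classical all_reals all_analysis.

Set Implicit Arguments.
Unset Strict Implicit.
Unset Printing Implicit Defensive.

Import Order.TTheory GRing.Theory Num.Theory.
Import numFieldNormedType.Exports.

Local Open Scope classical_set_scope.
Local Open Scope ring_scope.

(* R^d is 'rV[R]_d. The norm `|x| that the library puts on 'rV[R]_d is the
   sup norm; enorm is the Euclidean one. They induce the same topology and the
   same bounded sets, so the library's nbhs, open, closure, limits,
   differentiability and bounded_set are used directly. *)

Section Euclidean.
Context {R : realType} {d : nat}.
Implicit Types (x y : 'rV[R]_d) (A : set 'rV[R]_d).

Definition dotv x y : R := \sum_(i < d) x ord0 i * y ord0 i.

Definition enorm x : R := Num.sqrt (dotv x x).

(* The distance to the empty set is +oo. *)
Definition dist x A : \bar R := ereal_inf [set (enorm (x - y))%:E | y in A].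

Definition lipschitz_in A (F : 'rV[R]_d -> 'rV[R]_d) : Prop :=
  exists K : R, forall x y, A x -> A y ->
    enorm (F x - F y) <= K * enorm (x - y).

Definition locally_lipschitz_in A (F : 'rV[R]_d -> 'rV[R]_d) : Prop :=
  forall x, A x -> exists2 U, nbhs x U & lipschitz_in (U `&` A) F.

End Euclidean.

(* A function with values in (-oo, +oo] is a function into \bar R that avoids
   -oo; the latter is part of proper_fun. *)
Section ExtendedRealFunctions.
Context {R : realType} {d : nat}.
Implicit Types (f : 'rV[R]_d -> \bar R) (x y xi : 'rV[R]_d).

Definition dom f : set 'rV[R]_d := [set x | (f x < +oo)%E].

Definition proper_fun f : Prop := (forall x, f x != -oo%E) /\ dom f !=set0.

Definition econvex f : Prop :=
  forall x y (t : R), 0 < t < 1 ->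
    (f (t *: x + (1 - t) *: y)%R <= t%:E * f x + (1 - t)%:E * f y)%E.

Definition strongly_convex (sigma : R) f : Prop :=
  forall x y (t : R), 0 < t < 1 ->
    (f (t *: x + (1 - t) *: y)%R
     + (sigma / 2 * t * (1 - t) * enorm (x - y) ^+ 2)%:E
     <= t%:E * f x + (1 - t)%:E * f y)%E.

(* Meaningful at points around which f is finite and differentiable. *)
Definition grad f x : 'rV[R]_d :=
  \row_(i < d) 'D_(delta_mx ord0 i) (fun y => fine (f y) : R) x.

(* Used only for open A. *)
Definition C1_on (A : set 'rV[R]_d) f : Prop :=
  forall x, A x ->
    [/\ f x \is a fin_num,
        differentiable (fun y => fine (f y) : R) x
      & {for x, continuous (grad f)}].

Definition level_bounded f : Prop :=
  forall r : R, bounded_set [set x | (f x <= r%:E)%E].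

(* f u / ||u|| tends to +oo as ||u|| tends to +oo. *)
Definition supercoercive f : Prop :=
  forall A : R, exists M : R, forall u, M < enorm u ->
    (A%:E <= f u * (enorm u)^-1%:E)%E.

(* In \bar R, +oo - +oo = -oo, so csubdiff f x is empty when f x = +oo (f
   proper). *)
Definition csubdiff f x : set 'rV[R]_d :=
  [set xi | forall y, (0 <= f y - f x - (dotv xi (y - x))%:E)%E].

(* x^' is the filter of punctured neighborhoods, i.e. y -> x with y != x. *)
Definition regular_subdiff f x : set 'rV[R]_d :=
  [set xi | dom f x /\
    (0 <= limf_einf (fun y => (f y - f x - (dotv xi (y - x))%:E)
                              * (enorm (y - x))^-1%:E) x^')%E].

Definition limiting_subdiff f x : set 'rV[R]_d :=
  [set xi | dom f x /\
    exists (xs xis : nat -> 'rV[R]_d),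
      [/\ xs @ \oo --> x, f (xs k) @[k --> \oo] --> f x, xis @ \oo --> xi
        & forall k, regular_subdiff f (xs k) (xis k)]].

Definition dom_subdiff f : set 'rV[R]_d :=
  [set x | limiting_subdiff f x !=set0].

End ExtendedRealFunctions.

Section KurdykaLojasiewicz.
Context {R : realType} {d : nat}.
Implicit Types (f : 'rV[R]_d -> \bar R) (x : 'rV[R]_d).

(* The class Xi_eta; phi is a total function, constrained only on [0, eta). *)
Definition desingularizing (eta : \bar R) (phi : R -> R) : Prop :=
  let I := [set t : R | 0 <= t /\ (t%:E < eta)%E] in
  [/\ {within I, continuous phi},
      convex_function (E := R^o) I (fun t => - phi t),
      forall t, I t -> 0 <= phi t,
      phi 0 = 0
    & forall t, 0 < t -> (t%:E < eta)%E ->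
        [/\ derivable phi t 1, {for t, continuous (derive1 phi)}
          & 0 < derive1 phi t]].

Definition KL_at f x : Prop :=
  exists (eta : \bar R) (U : set 'rV[R]_d) (phi : R -> R),
    [/\ (0 < eta)%E, nbhs x U, desingularizing eta phi
      & forall y, U y -> (f x < f y)%E -> (f y < f x + eta)%E ->
          (1 <= (derive1 phi (fine (f y - f x)))%:E
                * dist 0%R (limiting_subdiff f y))%E].

Definition KL_function f : Prop := forall x, dom_subdiff f x -> KL_at f x.

End KurdykaLojasiewicz.

Section BregmanDC.
Context {R : realType} {d : nat}.
Implicit Types (C : set 'rV[R]_d) (h f g : 'rV[R]_d -> \bar R).

Record kernel_generating C h : Prop := KernelGenerating {
  kg_proper : proper_fun h ;
  kg_lsc : lower_semicontinuous h ;
  kg_convex : econvex h ;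
  kg_dom : dom h `<=` closure C ;
  kg_dom_subdiff : dom_subdiff h = C ;
  kg_int_dom : (dom h)^° = C ;
  kg_C1 : C1_on C h }.

Definition bregman h (x y : 'rV[R]_d) : \bar R :=
  (h x - h y - (dotv (grad h y) (x - y))%:E)%E.

Record smad (L : R) C f h : Prop := Smad {
  smad_kernel : kernel_generating C h ;
  smad_proper : proper_fun f ;
  smad_lsc : lower_semicontinuous f ;
  smad_dom : dom h `<=` dom f ;
  smad_C1 : C1_on C f ;
  smad_sub : convex_function (E := 'rV[R]_d) C
    (fun x => L * fine (h x) - fine (f x)) ;
  smad_add : convex_function (E := 'rV[R]_d) C
    (fun x => L * fine (h x) + fine (f x)) }.

Definition Psi f1 f2 g (x : 'rV[R]_d) : \bar R := (f1 x - f2 x + g x)%E.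

Definition optimal_value C f1 f2 g : \bar R :=
  ereal_inf (Psi f1 f2 g @` closure C).

Record basic_assumptions C f1 f2 g h : Prop := BasicAssumptions {
  ba_kernel : kernel_generating C h ;
  ba_closure : closure C = closure (dom h) ;
  ba_f1_proper : proper_fun f1 ;
  ba_f1_convex : econvex f1 ;
  ba_f1g_dom : dom h `<=` dom (fun x => f1 x + g x)%E ;
  ba_f1_C1 : C1_on C f1 ;
  ba_f2_proper : proper_fun f2 ;
  ba_f2_convex : econvex f2 ;
  ba_g_proper : proper_fun g ;
  ba_g_lsc : lower_semicontinuous g ;
  ba_g_dom : dom g `&` C !=set0 ;
  ba_bounded : (-oo < optimal_value C f1 f2 g)%E ;
  ba_supercoercive : forall lambda : R, 0 < lambda ->
    supercoercive (fun u => lambda%:E * g u + h u)%E }.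

Definition subproblem f1 g h (lambda : R) (x xi u : 'rV[R]_d) : \bar R :=
  (g u + (dotv (grad f1 x - xi) (u - x))%:E
   + (lambda^-1)%:E * bregman h u x)%E.

Definition argmin (A : set 'rV[R]_d) f : set 'rV[R]_d :=
  [set u | A u /\ forall v, A v -> (f u <= f v)%E].

(* The set T_lambda(x), with its dependence on the subgradient xi explicit. *)
Definition bregman_prox C f1 g h (lambda : R) (x xi : 'rV[R]_d) :
    set 'rV[R]_d :=
  argmin (closure C) (subproblem f1 g h lambda x xi).

Definition BPDCA C f1 f2 g h (lambda : R) (x : nat -> 'rV[R]_d) : Prop :=
  C (x 0%N) /\
  exists xi : nat -> 'rV[R]_d, forall k,
    csubdiff f2 (x k) (xi k) /\
    bregman_prox C f1 g h lambda (x k) (xi k) (x k.+1).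

Definition limiting_critical f1 f2 g : set 'rV[R]_d :=
  [set x | exists xi zeta, [/\ csubdiff f2 x xi, limiting_subdiff g x zeta
                             & 0 = grad f1 x - xi + zeta]].

Definition limiting_stationary f1 f2 g : set 'rV[R]_d :=
  [set x | limiting_subdiff (Psi f1 f2 g) x 0].

End BregmanDC.

(* Main.v *)
Require Import Defs.
From HB Require Import structures.
From mathcomp Require Import all_boot all_order all_algebra.
From mathcomp Require Import all_classical all_reals all_analysis.
From mathcomp Require Import ring lra.
Import Order.TTheory GRing.Theory Num.Theory.
Import numFieldNormedType.Exports.
Local Open Scope classical_set_scope.
Local Open Scope ring_scope.

Set Implicit Arguments.
Unset Strict Implicit.

(* Since dom h = R^d, C = R^d and f1, f2, g, h are all finite.  Comparing the
   minimizer x^{k+1} with x^k, the convexity of L h - f1 and of f2 and the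
   strong convexity of h give the sufficient decrease
     Psi(x^{k+1}) + c |x^{k+1} - x^k|^2 <= Psi(x^k),
   so the iterates are bounded and the steps tend to 0.  The optimality
   condition of the subproblem makes every cluster point limiting critical,
   hence a point of N0; by compactness f2 is eventually differentiable at the
   iterates, xi^k is then grad f2 (x^k), and Psi has a subgradient at x^{k+1}
   of norm at most b |x^{k+1} - x^k|.  Finally the KL inequality at one cluster
   point xs gives, as long as the iterates stay near xs,
     2 a_{k+1} <= a_k + (b / c) (Delta_k - Delta_{k+1}),
   where a_k = |x^k - x^{k-1}| and Delta_k = phi(Psi(x^k) - Psi(xs)).  Summing,
   the iterates never leave an arbitrarily small ball around xs once a_k,
   Delta_k and |x^k - xs| are all small. *)

(** * Euclidean norm *)

Section EuclideanSpace.
Context {R : realType} {d : nat}.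
Implicit Types (x y z : 'rV[R]_d) (a : R).

Lemma dotvC x y : dotv x y = dotv y x.
Proof. by apply: eq_bigr => i _; rewrite mulrC. Qed.

Lemma dotvDl x y z : dotv (x + y) z = dotv x z + dotv y z.
Proof. by rewrite /dotv -big_split; apply: eq_bigr => i _; rewrite mxE mulrDl. Qed.

Lemma dotvZl a x y : dotv (a *: x) y = a * dotv x y.
Proof. by rewrite /dotv mulr_sumr; apply: eq_bigr => i _; rewrite mxE mulrA. Qed.

Lemma dotvNl x y : dotv (- x) y = - dotv x y.
Proof. by rewrite -scaleN1r dotvZl mulN1r. Qed.

Lemma dotvBl x y z : dotv (x - y) z = dotv x z - dotv y z.
Proof. by rewrite dotvDl dotvNl. Qed.

Lemma dotvDr x y z : dotv x (y + z) = dotv x y + dotv x z.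
Proof. by rewrite dotvC dotvDl !(dotvC x). Qed.

Lemma dotvZr a x y : dotv x (a *: y) = a * dotv x y.
Proof. by rewrite dotvC dotvZl dotvC. Qed.

Lemma dotvNr x y : dotv x (- y) = - dotv x y.
Proof. by rewrite dotvC dotvNl dotvC. Qed.

Lemma dotvBr x y z : dotv x (y - z) = dotv x y - dotv x z.
Proof. by rewrite dotvDr dotvNr. Qed.

Lemma dotv0r x : dotv x 0 = 0.
Proof. by rewrite -(subrr x) dotvBr subrr. Qed.

Lemma dotvv_ge0 x : 0 <= dotv x x.
Proof. by apply: sumr_ge0 => i _; rewrite -expr2 sqr_ge0. Qed.

Lemma enorm_ge0 x : 0 <= enorm x.
Proof. exact: sqrtr_ge0. Qed.

Lemma sqr_enorm x : enorm x ^+ 2 = dotv x x.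
Proof. by rewrite sqr_sqrtr // dotvv_ge0. Qed.

Lemma enorm0 : enorm (0 : 'rV[R]_d) = 0.
Proof. by rewrite /enorm dotv0r sqrtr0. Qed.

Lemma enormN x : enorm (- x) = enorm x.
Proof. by rewrite /enorm dotvNl dotvNr opprK. Qed.

Lemma enormB x y : enorm (x - y) = enorm (y - x).
Proof. by rewrite -enormN opprB. Qed.

Lemma enormZ a x : enorm (a *: x) = `|a| * enorm x.
Proof.
by rewrite /enorm dotvZl dotvZr mulrA -expr2 sqrtrM ?sqr_ge0// sqrtr_sqr.
Qed.

Lemma coord_le_norm x i : `|x ord0 i| <= `|x|.
Proof.
rewrite [leRHS]mx_normrE.
exact: (le_bigmax _ (fun ij : 'I_1 * 'I_d => `|x ij.1 ij.2|) (ord0, i)).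
Qed.

Lemma coord_le_enorm x i : `|x ord0 i| <= enorm x.
Proof.
rewrite -sqrtr_sqr ler_sqrt ?dotvv_ge0// /dotv (bigD1 i)//= -expr2 lerDl.
by apply: sumr_ge0 => j _; rewrite -expr2 sqr_ge0.
Qed.

Lemma normr_le_enorm x : `|x| <= enorm x.
Proof.
rewrite [leLHS]mx_normrE; apply: bigmax_le; first exact: enorm_ge0.
by move=> [i j] _ /=; rewrite (ord1 i) coord_le_enorm.
Qed.

(** The factor [d.+1] is cruder than the square root of [d], but it stays positive for [d = 0], so
    [nbhs_enormP] can divide by it. *)
Lemma enorm_le_normr x : enorm x <= d.+1%:R * `|x|.
Proof.
rewrite -(@ger0_norm _ (d.+1%:R * `|x|)) ?mulr_ge0// -sqrtr_sqr ler_sqrt ?sqr_ge0//.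
apply: (@le_trans _ _ (\sum_(i < d) `|x| ^+ 2)).
  apply: ler_sum => i _; rewrite -expr2 -real_normK ?num_real//.
  by rewrite lerXn2r ?nnegrE// coord_le_norm.
rewrite sumr_const card_ord -[_ *+ d]mulr_natl exprMn ler_wpM2r ?sqr_ge0//.
by rewrite -natrX ler_nat -mulnn (leq_trans (leqnSn d))// leq_pmulr.
Qed.

Lemma enorm_eq0 x : (enorm x == 0) = (x == 0).
Proof.
apply/eqP/eqP => [x0|->]; last exact: enorm0.
by apply/eqP; rewrite -normr_le0 (le_trans (normr_le_enorm x)) ?x0.
Qed.

Lemma CauchySchwarz_dotv x y : dotv x y <= enorm x * enorm y.
Proof.
have [->|x0] := eqVneq x 0; first by rewrite dotvC dotv0r enorm0 mul0r.
have [->|y0] := eqVneq y 0; first by rewrite dotv0r enorm0 mulr0.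
have xp : 0 < enorm x by rewrite lt_neqAle eq_sym enorm_eq0 x0 enorm_ge0.
have yp : 0 < enorm y by rewrite lt_neqAle eq_sym enorm_eq0 y0 enorm_ge0.
(* The square of this vector is the gap in the inequality times a positive factor. *)
have := dotvv_ge0 (enorm y *: x - enorm x *: y).
rewrite !(dotvBl, dotvBr, dotvZl, dotvZr) -!sqr_enorm (dotvC y x).
rewrite (_ : _ - _ =
  2 * (enorm x * enorm y) * (enorm x * enorm y - dotv x y)); last by ring.
by rewrite pmulr_rge0 ?subr_ge0// !mulr_gt0.
Qed.

Lemma normr_dotv_le x y : `|dotv x y| <= enorm x * enorm y.
Proof.
rewrite ler_norml CauchySchwarz_dotv andbT lerNl -dotvNl.
by rewrite (le_trans (CauchySchwarz_dotv _ _))// enormN.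
Qed.

Lemma ler_enormD x y : enorm (x + y) <= enorm x + enorm y.
Proof.
have s0 : 0 <= enorm x + enorm y by rewrite addr_ge0// enorm_ge0.
rewrite -(ler_pXn2r (n := 2)) ?nnegrE ?enorm_ge0//.
rewrite sqr_enorm dotvDl !dotvDr -!sqr_enorm (dotvC y x) sqrrD.
by have := CauchySchwarz_dotv x y; lra.
Qed.

Lemma ler_enormB x y : enorm (x - y) <= enorm x + enorm y.
Proof. by rewrite (le_trans (ler_enormD _ _))// enormN. Qed.

Lemma ler_enorm_dist x y z : enorm (x - z) <= enorm (x - y) + enorm (y - z).
Proof. by rewrite (_ : x - z = (x - y) + (y - z)) ?ler_enormD// addrA subrK. Qed.

Lemma nbhs_enormP x (A : set 'rV[R]_d) :
  nbhs x A <-> exists2 e, 0 < e & forall y, enorm (y - x) < e -> A y.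
Proof.
split=> [/nbhs_ballP[e /= e0 eA]|[e e0 eA]].
  exists e => // y yx; apply: eA; rewrite -ball_normE /= -normrN opprB.
  exact: le_lt_trans (normr_le_enorm _) yx.
apply/nbhs_ballP; exists (e / d.+1%:R); first by rewrite /= divr_gt0.
move=> y; rewrite -ball_normE /= -normrN opprB => xy; apply: eA.
by rewrite (le_lt_trans (enorm_le_normr _))// mulrC -ltr_pdivlMr.
Qed.

Lemma near_enorm_lt x e : 0 < e -> \forall y \near x, enorm (y - x) < e.
Proof. by move=> e0; apply/nbhs_enormP; exists e. Qed.

Lemma cvg_enormP (T : Type) (F : set_system T) {FF : Filter F}
    (u : T -> 'rV[R]_d) x :
  u @ F --> x <-> forall e, 0 < e -> \forall n \near F, enorm (u n - x) < e.
Proof.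
split=> [ux e e0|ux].
  exact: (ux _ (near_enorm_lt x e0)).
move=> A /nbhs_enormP[e e0 eA]; rewrite /= /nbhs /=.
by apply: filterS (ux _ e0) => n; exact: eA.
Qed.

Lemma cvg_enorm0P (T : Type) (F : set_system T) {FF : Filter F}
    (u : T -> 'rV[R]_d) x :
  u @ F --> x <-> enorm (u n - x) @[n --> F] --> (0 : R).
Proof.
apply: (iff_trans (cvg_enormP u x)); split=> [ux|/cvgrPdist_lt ux e e0].
  apply/cvgrPdist_lt => e /ux; apply: filterS => n.
  by rewrite sub0r normrN ger0_norm ?enorm_ge0.
apply: filterS (ux e e0) => n.
by rewrite sub0r normrN ger0_norm ?enorm_ge0.
Qed.

Lemma cvg_dotv (T : Type) (F : set_system T) {FF : Filter F}
    (u v : T -> 'rV[R]_d) x y :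
  u @ F --> x -> v @ F --> y -> dotv (u n) (v n) @[n --> F] --> dotv x y.
Proof.
move=> ux vy; rewrite /dotv; elim: (index_enum _) => [|i s IHs].
  under eq_fun do rewrite big_nil.
  by rewrite big_nil; exact: cvg_cst.
under eq_fun do rewrite big_cons.
rewrite big_cons; apply: cvgD IHs; apply: cvgM.
  exact: (cvg_comp _ _ ux (@coord_continuous _ _ _ ord0 i x)).
exact: (cvg_comp _ _ vy (@coord_continuous _ _ _ ord0 i y)).
Qed.

Lemma bounded_set_enorm (A : set 'rV[R]_d) (M : R) :
  (forall x, A x -> enorm x <= M) -> bounded_set A.
Proof.
move=> AM; exists M; split; first exact: num_real.
move=> N MN x Ax; rewrite /= (le_trans (normr_le_enorm x))//.
by rewrite (le_trans (AM _ Ax))// ltW.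
Qed.

Lemma bounded_set_enorm_le (A : set 'rV[R]_d) :
  bounded_set A -> exists M : R, forall x, A x -> enorm x <= M.
Proof.
move=> [M [_ AM]]; exists (d.+1%:R * (M + 1)) => x Ax.
rewrite (le_trans (enorm_le_normr x))// ler_wpM2l//.
by apply: AM => //; rewrite ltrDl.
Qed.

Lemma dist0_ge0 (A : set 'rV[R]_d) : (0 <= dist 0 A)%E.
Proof. by apply: le_ereal_inf_tmp => _ [y _ <-]; rewrite lee_fin enorm_ge0. Qed.

Lemma dist0_le (A : set 'rV[R]_d) z : A z -> (dist 0 A <= (enorm z)%:E)%E.
Proof.
by move=> Az; apply: ereal_inf_lbound; exists z => //; rewrite sub0r enormN.
Qed.

End EuclideanSpace.

(** * Gradients and subgradients *)

Section Calculus.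
Context {R : realType} {d : nat}.
Implicit Types (x y v xi G : 'rV[R]_d) (F : 'rV[R]_d -> R).

(** Fréchet differentiability in epsilon form. Multiplying out the norm removes the quotient, so
    [y = x] needs no exception. *)
Definition gradient_at F x G : Prop := forall e, 0 < e ->
  \forall y \near x, `|F y - F x - dotv G (y - x)| <= e * enorm (y - x).

Definition regular_subgradient F x xi : Prop := forall e, 0 < e ->
  \forall y \near x, - (e * enorm (y - x)) <= F y - F x - dotv xi (y - x).

Definition convex_subgradient F x xi : Prop :=
  forall y, F x + dotv xi (y - x) <= F y.

(** With [s = 0] this is plain convexity, so that [convex_gradient_le] serves both [h] and
    [L h - f1]. *)
Definition convex_modulus (s : R) F : Prop :=
  forall x y (t : R), 0 < t < 1 ->
    F (t *: x + (1 - t) *: y) + s / 2 * t * (1 - t) * enorm (x - y) ^+ 2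
    <= t * F x + (1 - t) * F y.

Lemma diff_dotv_grad (f : 'rV[R]_d -> \bar R) x v :
  differentiable (fun y => fine (f y) : R) x ->
  'd (fun y => fine (f y) : R) x v = dotv (grad f x) v.
Proof.
move=> df; rewrite [in LHS](row_sum_delta v) linear_sum /dotv.
by apply: eq_bigr => i _; rewrite linearZ /= mxE deriveE// mulrC.
Qed.

Lemma differentiable_gradient_at (f : 'rV[R]_d -> \bar R) x :
  differentiable (fun y => fine (f y) : R) x ->
  gradient_at (fun y => fine (f y)) x (grad f x).
Proof.
move=> df e e0; have /diff_locally/eqaddoP/(_ e e0) := df.
move=> /(nbhs_enormP 0)[r r0 re]; apply/nbhs_enormP; exists r => // y yx.
have := re (y - x); rewrite subr0 => /(_ yx) /=.
rewrite !fctE /= subrK diff_dotv_grad// opprD addrA => /le_trans; apply.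
by rewrite ler_wpM2l ?normr_le_enorm// ltW.
Qed.

Lemma gradient_atN F x G :
  gradient_at F x G -> gradient_at (fun y => - F y) x (- G).
Proof.
move=> FG e /FG; apply: filterS => y; rewrite dotvNl -normrN.
by rewrite !opprD !opprK.
Qed.

Lemma gradient_atD F1 F2 x G1 G2 :
  gradient_at F1 x G1 -> gradient_at F2 x G2 ->
  gradient_at (fun y => F1 y + F2 y) x (G1 + G2).
Proof.
move=> FG1 FG2 e e0; have e20 : 0 < e / 2 by rewrite divr_gt0.
near=> y; rewrite dotvDl.
have -> : F1 y + F2 y - (F1 x + F2 x) - (dotv G1 (y - x) + dotv G2 (y - x)) =
  (F1 y - F1 x - dotv G1 (y - x)) + (F2 y - F2 x - dotv G2 (y - x)) by ring.
rewrite (le_trans (ler_normD _ _))// (splitr e) mulrDl lerD//.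
  by near: y; exact: FG1.
by near: y; exact: FG2.
Unshelve. all: by end_near. Qed.

Lemma gradient_atZ a F x G :
  gradient_at F x G -> gradient_at (fun y => a * F y) x (a *: G).
Proof.
move=> FG e e0; have a0 : 0 < `|a| + 1 by rewrite ltr_wpDl.
have := FG _ (divr_gt0 e0 a0); apply: filterS => y Fy.
rewrite dotvZl -!mulrBr normrM (le_trans (ler_wpM2l _ Fy))//.
rewrite mulrA ler_wpM2r ?enorm_ge0// mulrCA ger_pMr//.
by rewrite ler_pdivrMr// mul1r lerDl.
Qed.

Lemma gradient_atB F1 F2 x G1 G2 :
  gradient_at F1 x G1 -> gradient_at F2 x G2 ->
  gradient_at (fun y => F1 y - F2 y) x (G1 - G2).
Proof. by move=> FG1 /gradient_atN; exact: gradient_atD. Qed.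

Lemma gradient_at_line F x G v e : gradient_at F x G -> 0 < e ->
  exists2 r, 0 < r & forall t, 0 < t < r ->
    `|F (x + t *: v) - F x - t * dotv G v| <= t * e.
Proof.
move=> FG e0; have v0 : 0 < enorm v + 1 by rewrite ltr_wpDl// enorm_ge0.
have /nbhs_enormP[r r0 Hr] := FG _ (divr_gt0 e0 v0).
exists (r / (enorm v + 1)); first exact: divr_gt0.
move=> t /andP[t0 tr]; have := Hr (x + t *: v).
rewrite (addrC x) addrK enormZ gtr0_norm// dotvZr => Hv.
have tv : t * enorm v < r.
  rewrite ltr_pdivlMr// in tr; apply: le_lt_trans tr.
  by rewrite ler_wpM2l ?lerDl// ltW.
apply: le_trans (Hv tv) _; rewrite mulrCA ler_wpM2l//; first exact: ltW.
by rewrite mulrAC ler_pdivrMr// ler_wpM2l ?lerDl// ltW.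
Qed.

(** A short move of length parameter t along [xi - G] raises [F] by at least t times the [xi]-slope
    and at most t times the [G]-slope plus t e; hence the squared norm of [xi - G] is at most e. *)
Lemma gradient_at_subgradient F x G xi :
  gradient_at F x G -> convex_subgradient F x xi -> xi = G.
Proof.
move=> FG Fxi; apply/eqP; rewrite -subr_eq0 -enorm_eq0 -sqrf_eq0.
rewrite eq_le sqr_ge0 andbT sqr_enorm; apply/ler_addgt0Pr => e e0.
have [r r0 Hr] := gradient_at_line (xi - G) FG e0.
have r20 : 0 < r / 2 by rewrite divr_gt0.
have r2 : 0 < r / 2 < r by lra.
have := Hr _ r2; have := Fxi (x + (r / 2) *: (xi - G)).
rewrite (addrC x) addrK dotvZr ler_norml => Hx /andP[_ Hy].
rewrite add0r -(ler_pM2l r20) dotvBl mulrBr; lra.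
Qed.

(** Divide the convexity inequality at [y + t (x - y)] by t and let t tend to 0. *)
Lemma convex_gradient_le s F x y G : convex_modulus s F -> gradient_at F y G ->
  F y + dotv G (x - y) + s / 2 * enorm (x - y) ^+ 2 <= F x.
Proof.
move=> sF FG; apply/ler_addgt0Pr => e e0.
have e20 : 0 < e / 2 by rewrite divr_gt0.
have [r r0 Hr] := gradient_at_line (x - y) FG e20.
set q := s / 2 * enorm (x - y) ^+ 2.
have q0 : 0 < `|q| + 1 by rewrite ltr_wpDl.
(* The three bounds keep t in the range of the gradient estimate, keep it below 1, and make the
   second-order remainder [t * q] at most [e / 2]. *)
pose t := Num.min (r / 2) (Num.min (1 / 2) (e / 2 / (`|q| + 1))).
have t0 : 0 < t by rewrite !lt_min !divr_gt0//.
have tr : t <= r / 2 by rewrite ge_min lexx.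
have t1 : t <= 1 / 2 by rewrite !ge_min lexx orbT.
have tq : t * q <= e / 2.
  have : t <= e / 2 / (`|q| + 1) by rewrite !ge_min lexx !orbT.
  rewrite ler_pdivlMr//; apply: le_trans.
  by rewrite ler_wpM2l ?(ltW t0)// (le_trans (ler_norm q))// lerDl.
have tr' : 0 < t < r by lra.
have t1' : 0 < t < 1 by lra.
have := Hr _ tr'; have := sF x y t t1'.
rewrite (_ : t *: x + (1 - t) *: y = y + t *: (x - y)); last first.
  by rewrite scalerBl scale1r scalerBr addrCA.
rewrite ler_norml => Hx /andP[Hy _].
rewrite -(ler_pM2l t0).
have : s / 2 * t * (1 - t) * enorm (x - y) ^+ 2 = t * q - t * (t * q).
  by rewrite /q; ring.
have : t * (t * q) <= t * (e / 2) by rewrite ler_wpM2l// ltW.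
rewrite !mulrDr -/q; lra.
Qed.

Lemma regular_subgradientD F1 F2 x xi G :
  regular_subgradient F1 x xi -> gradient_at F2 x G ->
  regular_subgradient (fun y => F1 y + F2 y) x (xi + G).
Proof.
move=> F1xi F2G e e0; have e20 : 0 < e / 2 by rewrite divr_gt0.
have := F2G _ e20; apply: filterS2 (F1xi _ e20) => y Fxi.
rewrite ler_norml => /andP[FG _]; rewrite dotvDl.
by rewrite (splitr e) mulrDl; lra.
Qed.

Lemma regular_subdiff_intro (f : 'rV[R]_d -> \bar R) F x xi :
  (forall y, f y = (F y)%:E) -> regular_subgradient F x xi ->
  regular_subdiff f x xi.
Proof.
move=> fF Fxi; split; first by rewrite /dom /= fF ltry.
rewrite limf_einfE; apply/lee_addgt0Pr => e e0.
rewrite -leeBlDr// sub0e.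
(* The liminf is a supremum of infima over punctured neighborhoods; on [V] the quotient is at least
   [- e]. *)
set V := [set y | - (e * enorm (y - x)) <= F y - F x - dotv xi (y - x)
                  /\ y != x].
apply: le_trans (ereal_sup_ubound _); last first.
  exists V => //; rewrite /dnbhs /within /= .
  by apply: filterS (Fxi _ e0) => y Fy yx; split.
apply: le_ereal_inf_tmp => _ [y [Fy yx] <-].
have y0 : 0 < enorm (y - x).
  by rewrite lt_neqAle eq_sym enorm_eq0 subr_eq0 yx enorm_ge0.
by rewrite !fF -!EFinB -EFinM -EFinN lee_fin ler_pdivlMr// mulNr.
Qed.

Lemma regular_limiting_subdiff (f : 'rV[R]_d -> \bar R) x xi :
  regular_subdiff f x xi -> limiting_subdiff f x xi.
Proof.
move=> fxi; split; first by case: fxi.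
by exists (fun=> x), (fun=> xi); split => //; exact: cvg_cst.
Qed.

End Calculus.

(** * Finite convex functions and subsequences *)

Section FiniteConvex.
Context {R : realType} {d : nat}.
Implicit Types (x y v xi : 'rV[R]_d) (F : 'rV[R]_d -> R).

Lemma convex_modulus0 F : convex_modulus 0 F <->
  forall x y (t : R), 0 < t < 1 ->
    F (t *: x + (1 - t) *: y) <= t * F x + (1 - t) * F y.
Proof.
by split=> cF x y t /cF => /(_ x y); rewrite !mul0r ?addr0.
Qed.

Lemma convex_axis_bounded F (i : 'I_d) (M : R) : convex_modulus 0 F -> 0 < M ->
  exists B, forall a : R, `|a| <= M -> F (a *: delta_mx ord0 i) <= B.
Proof.
move=> /convex_modulus0 cF M0; set e := delta_mx ord0 i.
pose B := Num.max (F (M *: e)) (F ((- M) *: e)).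
have B1 : F (M *: e) <= B by rewrite le_max lexx.
have B2 : F ((- M) *: e) <= B by rewrite le_max lexx orbT.
exists B => a; rewrite ler_norml => /andP[aM1 aM2].
(* The endpoints are set apart because [convex_modulus] only allows [0 < t < 1]. *)
have [->//|aM] := eqVneq a M.
have [->//|aNM] := eqVneq a (- M).
have {}aM1 : - M < a by rewrite lt_neqAle eq_sym aNM.
have {}aM2 : a < M by rewrite lt_neqAle aM.
have M20 : 0 < 2 * M by rewrite mulr_gt0.
pose t := (a + M) / (2 * M).
have t01 : 0 < t < 1.
  by apply/andP; split; [apply: divr_gt0 => //; lra|rewrite ltr_pdivrMr//; lra].
have -> : a *: e = t *: (M *: e) + (1 - t) *: ((- M) *: e).
  rewrite !scalerA -scalerDl; congr (_ *: _).
  by rewrite /t; field; rewrite gt_eqF.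
apply: le_trans (cF _ _ _ t01) _; case/andP: t01 => t0 t1.
have -> : B = t * B + (1 - t) * B by ring.
by apply: lerD; rewrite ler_wpM2l//; lra.
Qed.

(** Induction on the number k of leading coordinates that may be nonzero. The claim ranges over all
    box sizes [N] because the midpoint step doubles the coordinates. *)
Lemma convex_bounded_above F (M : R) : convex_modulus 0 F ->
  exists B, forall x, enorm x <= M -> F x <= B.
Proof.
move=> cF.
suff H k : (k <= d)%N -> forall N : R, 0 < N -> exists B, forall x,
    (forall i : 'I_d, `|x ord0 i| <= N) ->
    (forall i : 'I_d, (k <= i)%N -> x ord0 i = 0) -> F x <= B.
  have M0 : 0 < `|M| + 1 by rewrite ltr_wpDl.
  have [B HB] := H d (leqnn d) _ M0; exists B => x xM; apply: HB => i; last first.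
    by rewrite leqNgt ltn_ord.
  rewrite (le_trans (coord_le_enorm x i))// (le_trans xM)//.
  by rewrite (le_trans (ler_norm M))// lerDl.
elim: k => [_ N N0|k IHk kd N N0].
  exists (F 0) => x _ x0; rewrite (_ : x = 0)//.
  by apply/rowP => i; rewrite mxE x0.
pose ik := Ordinal kd.
have N20 : 0 < 2 * N by rewrite mulr_gt0.
have [B1 HB1] := IHk (ltnW kd) _ N20.
have [B2 HB2] := convex_axis_bounded ik cF N20.
exists (1 / 2 * B1 + (1 - (1 / 2)) * B2) => x xN x0.
(* x is the midpoint of twice its first k coordinates and twice the last one. *)
pose x' : 'rV[R]_d := x - x ord0 ik *: delta_mx ord0 ik.
have h2 : 0 < (1 / 2 : R) < 1 by lra.
have -> : x = 1 / 2 *: (2 *: x') + (1 - (1 / 2)) *: ((2 * x ord0 ik) *: delta_mx ord0 ik).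
  rewrite !scalerA (_ : (1 - (1 / 2)) * (2 * x ord0 ik) = x ord0 ik); last by field.
  by rewrite div1r mulVf// scale1r /x' subrK.
move/convex_modulus0 : (cF) => /(_ _ _ _ h2) cF'.
apply: le_trans (cF' _ _) _; apply: lerD; apply: ler_wpM2l; [lra| |lra|].
- apply: HB1 => i.
    rewrite !mxE eqxx /= normrM ger0_norm// ler_pM2l//.
    by case: eqVneq => [->|_]; rewrite ?mulr1 ?subrr ?normr0 ?mulr0 ?subr0// ltW.
  move=> ki; rewrite !mxE eqxx /=.
  have [->|ik'] := eqVneq i ik; first by rewrite mulr1 subrr mulr0.
  rewrite mulr0 subr0 x0 ?mulr0// ltn_neqAle ki andbT.
  by apply: contra ik' => /eqP kE; apply/eqP/val_inj.
- by apply: HB2; rewrite normrM ger0_norm// ler_pM2l.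
Qed.

(** Boundedness above near x suffices. With [u = (y - x) / t] in the unit ball, y lies between x and
    [x + u], and x lies between [x - u] and y; the two convexity inequalities bound [F y - F x] from
    above and below by multiples of [t * (B - F x)]. *)
Lemma convex_continuous F : convex_modulus 0 F -> continuous F.
Proof.
move=> cF x; have [B0 HB0] := convex_bounded_above (enorm x + 1) cF.
(* Including [F x + 1] makes [B - F x] a positive divisor. *)
pose B := Num.max B0 (F x + 1).
have HB y : enorm (y - x) <= 1 -> F y <= B.
  move=> yx; rewrite le_max HB0// -(subrK x y) addrC.
  by rewrite (le_trans (ler_enormD _ _))// lerD2l.
have Bx : 0 < B - F x.
  by rewrite subr_gt0 lt_max ltrDl ltr01 orbT.
have /convex_modulus0 {}cF := cF.
apply/(@cvgrPdist_le _ _ _ (nbhs x) (nbhs_filter x)) => e e0.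
pose t := Num.min (1 / 2) (e / (B - F x)).
have t0 : 0 < t by rewrite lt_min !divr_gt0.
have t1 : t <= 1 / 2 by rewrite ge_min lexx.
have te : t * (B - F x) <= e by rewrite -ler_pdivlMr// ge_min lexx orbT.
apply: filterS (near_enorm_lt x t0) => y yx.
have t01 : 0 < t < 1 by lra.
have ht1 : 0 < t / (1 + t) < 1.
  by rewrite divr_gt0/= ?ltr_pdivrMr//; lra.
pose u := t^-1 *: (y - x).
have u1 : enorm u <= 1.
  by rewrite enormZ gtr0_norm ?invr_gt0// mulrC ler_pdivrMr// mul1r ltW.
have ut : t *: u = y - x by rewrite scalerA mulfV ?scale1r// gt_eqF.
clearbody u.
have yE : y = t *: (x + u) + (1 - t) *: x.
  by rewrite scalerDr ut scalerBl scale1r addrCA -addrA subrKC addrC subrK.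
have xE : x = (t / (1 + t)) *: (x - u) + (1 - t / (1 + t)) *: y.
  have -> : y = x + t *: u by rewrite ut addrC subrK.
  rewrite scalerBr scalerDr scalerA addrACA -scalerDl -scaleNr -scalerDl.
  rewrite (_ : _ + _ = 1) ?scale1r; last by ring.
  rewrite (_ : - (t / (1 + t)) + _ = 0) ?scale0r ?addr0//; field; lra.
have H1 := cF (x + u) x t t01; rewrite -yE in H1.
have H2 := cF (x - u) y _ ht1; rewrite -xE in H2.
have Hu1 : t * F (x + u) <= t * B.
  by apply: ler_wpM2l; [exact: ltW|apply: HB; rewrite addrC addKr].
have Hu2 : t * F (x - u) <= t * B.
  by apply: ler_wpM2l; [exact: ltW|apply: HB; rewrite addrC addKr enormN].
have {}H2 : (1 + t) * F x <= t * F (x - u) + F y.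
  have t10 : 0 < 1 + t by lra.
  rewrite (_ : t * F (x - u) + F y =
    (1 + t) * (t / (1 + t) * F (x - u) + (1 - t / (1 + t)) * F y)).
    by rewrite ler_pM2l.
  by field; lra.
rewrite ler_norml; apply/andP; split; lra.
Qed.

(** Testing the subgradient one unit along [xi] gives [enorm xi <= B - F x], and 0 as the midpoint
    of x and [- x] gives [F x >= 2 * F 0 - B]. *)
Lemma convex_subgradient_bounded F (M : R) : convex_modulus 0 F ->
  exists K, forall x xi, enorm x <= M -> convex_subgradient F x xi ->
    enorm xi <= K.
Proof.
move=> cF; have [B HB] := convex_bounded_above (`|M| + 1) cF.
have M1 : M <= `|M| + 1 by rewrite (le_trans (ler_norm M))// lerDl.
exists (Num.max 0 (2 * (B - F 0))) => x xi xM Fxi.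
have [->|xi0] := eqVneq xi 0; first by rewrite enorm0 le_max lexx.
have xip : 0 < enorm xi by rewrite lt_neqAle eq_sym enorm_eq0 xi0 enorm_ge0.
rewrite le_max; apply/orP; right.
pose y := x + (enorm xi)^-1 *: xi.
have : F y <= B.
  apply: HB; rewrite (le_trans (ler_enormD _ _))// enormZ.
  rewrite gtr0_norm ?invr_gt0// mulVf ?gt_eqF// lerD2r (le_trans xM)//.
  exact: ler_norm.
have : F (- x) <= B by apply: HB; rewrite enormN (le_trans xM).
have := Fxi y; rewrite /y (addrC x) addrK dotvZr -sqr_enorm expr2 mulKf ?gt_eqF//.
have h2 : 0 < (1 / 2 : R) < 1 by lra.
have /convex_modulus0/(_ x (- x) _ h2) := cF.
rewrite (_ : _ + _ = 0 :> 'rV[R]_d); first by lra.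
by rewrite scalerN -scalerBl (_ : _ - _ = 0) ?scale0r//; field.
Qed.

End FiniteConvex.

(** * Convergent subsequences of bounded sequences *)

Section Subsequences.
Context {R : realType} {d : nat}.
Implicit Types (u : nat -> 'rV[R]_d).

(** Subsequences are indexed by maps with [n <= p n], not necessarily increasing; tending to
    infinity is all that limits require, and the condition is stable under composition. *)
Lemma cvg_infty_ge (p : nat -> nat) : (forall n, n <= p n)%N -> p @ \oo --> \oo.
Proof.
move=> pn A [N _ NA]; exists N => // n /= Nn; apply: NA => /=.
exact: leq_trans (pn n).
Qed.

Lemma bounded_cvg_subsequence u (M : R) : (forall n, enorm (u n) <= M) ->
  exists (p : nat -> nat) (l : 'rV[R]_d),
    (forall n, (n <= p n)%N) /\ u (p n) @[n --> \oo] --> l.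
Proof.
move=> uM.
pose A := closed_ball (0 : 'rV[R]_d) (`|M| + 1).
have M0 : 0 < `|M| + 1 by rewrite ltr_wpDl.
have cA : compact A.
  apply: bounded_closed_compact; last exact: closed_ball_closed.
  exists (`|M| + 1); split; first exact: num_real.
  move=> N MN v; rewrite /A closed_ballE//= /closed_ball_ /= sub0r normrN.
  by move=> /le_trans; apply; exact: ltW.
have uA n : A (u n).
  rewrite /A closed_ballE//= /closed_ball_ /= sub0r normrN.
  rewrite (le_trans (normr_le_enorm _))// (le_trans (uM n))//.
  by rewrite (le_trans (ler_norm M))// lerDl.
have FA : (u @ \oo) A by exists 0%N => // n _; exact: uA.
have [l [_ cl]] := cA _ _ FA.
(* A cluster point is approached within [1 / (n + 1)] at some index beyond n. *)
have /choice[p Hp] : forall n, exists m,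
    (n <= m)%N /\ enorm (u m - l) < n.+1%:R^-1.
  move=> n; have [||_ [[m /= nm <-] Hm]] :=
    cl (u @` [set m | (n <= m)%N]) [set y | enorm (y - l) < n.+1%:R^-1].
  - by exists n => // m nm; exists m.
  - by apply: near_enorm_lt; rewrite invr_gt0.
  by exists m.
exists p, l; split=> [n|]; first exact: (Hp n).1.
apply/cvg_enormP => e e0.
near=> n; rewrite (lt_trans (Hp n).2)//.
by near: n; exact: near_infty_natSinv_lt (PosNum e0).
Unshelve. all: by end_near. Qed.

End Subsequences.

(** * Descent sequences and the KL inequality *)

Lemma convex_functionW (R : realType) (E : lmodType R) (D : set E)
    (f : E -> R) (x y : E) (t : R) : convex_function D f -> D x -> D y ->
  0 < t < 1 -> f (t *: x + (1 - t) *: y) <= t * f x + (1 - t) * f y.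
Proof.
move=> cf Dx Dy /andP[t0 t1].
by have := cf (Itv01 (ltW t0) (ltW t1)) x y; rewrite !inE => /(_ Dx Dy).
Qed.

(** The values decrease to a limit; once [v k] is within [c * e ^+ 2] of it, the next step has
    length below e. *)
Lemma sufficient_decrease_cvg0 (R : realType) (v a : nat -> R) (c m : R) :
  0 < c -> (forall k, 0 <= a k) -> (forall k, m <= v k) ->
  (forall k, v k.+1 + c * a k.+1 ^+ 2 <= v k) -> a k @[k --> \oo] --> (0 : R).
Proof.
move=> c0 a0 mv va.
have v_noninc : nonincreasing_seq v.
  apply/nonincreasing_seqP => k; apply: le_trans (va k).
  by rewrite lerDl mulr_ge0 ?sqr_ge0// ltW.
have v_cvg : cvg (v @ \oo).
  by apply: nonincreasing_is_cvgn => //; exists m => _ [k _ <-].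
apply/cvgrPdist_lt => e e0.
have ce0 : 0 < c * e ^+ 2 by rewrite mulr_gt0// exprn_gt0.
have vl : lim (v @ \oo) < lim (v @ \oo) + c * e ^+ 2 by rewrite ltrDl.
have [N _ HN] := cvgr_lt _ v_cvg _ vl.
exists N.+1 => // -[//|k] /= Nk.
rewrite sub0r normrN ger0_norm//.
rewrite -(ltr_pXn2r (n := 2)) ?nnegrE ?(ltW e0)// -(ltr_pM2l c0).
have := HN k Nk; have := va k; have := nonincreasing_cvgn_ge v_noninc v_cvg k.+1.
by rewrite /=; lra.
Qed.

Section KurdykaLojasiewiczDescent.
Context {R : realType} {d : nat}.

(** A chord of a concave function is at least as steep as the tangent at its right end. Only left
    difference quotients at t enter, so s may be the endpoint 0, where [phi] is not assumed
    differentiable. *)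
Lemma concave_tangent (D : set R) (phi : R -> R) (s t : R) :
  convex_function (E := R^o) D (fun r => - phi r) -> D s -> D t -> s < t ->
  derivable phi t 1 -> derive1 phi t * (t - s) <= phi t - phi s.
Proof.
move=> cphi Ds Dt st dphi.
have ts0 : 0 < t - s by rewrite subr_gt0.
rewrite -ler_pdivlMr//; apply/ler_addgt0Pr => e e0.
have /cvgrPdist_le/(_ e e0) : h^-1 *: (phi (h *: 1 + t) - phi t) @[h --> 0^']
    --> derive1 phi t by rewrite derive1E; exact: dphi.
rewrite /dnbhs /within /= => /nbhs_ballP[r /= r0 Hr].
(* The point [t - k (t - s)] is then strictly between s and t, and within r of t. *)
pose k := Num.min (1 / 2) (r / 2 / (t - s)).
have k0 : 0 < k by rewrite lt_min !divr_gt0.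
have k1 : k <= 1 / 2 by rewrite ge_min lexx.
have kr : k * (t - s) <= r / 2 by rewrite -ler_pdivlMr// ge_min lexx orbT.
have := Hr (- (k * (t - s))).
have kts : 0 < k * (t - s) by rewrite mulr_gt0.
rewrite -ball_normE /= sub0r opprK gtr0_norm// oppr_eq0 gt_eqF// => /(_ _ isT).
rewrite ler_norml => -/(_ _)/andP[|_]; first by lra.
have k01 : 0 < k < 1 by lra.
have := convex_functionW (E := R^o) cphi Ds Dt k01.
rewrite (_ : k *: (s : R^o) + _ = - (k * (t - s)) *: 1 + t); last first.
  by rewrite /GRing.scale /=; ring.
set q := phi (_ + _) => qk.
suff : (- (k * (t - s)))^-1 *: (q - phi t) <= (phi t - phi s) / (t - s) by lra.
rewrite /GRing.scale /= invrN mulNr -mulrN mulrC ler_pdivrMr// mulrCA.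
by rewrite -mulrA mulVf ?mulr1 ?gt_eqF//; lra.
Qed.

(** * Sequences with sufficient decrease, relative error and a cluster point *)

Context (f : 'rV[R]_d -> \bar R) (F : 'rV[R]_d -> R) (x : nat -> 'rV[R]_d).
Context (xs : 'rV[R]_d) (p : nat -> nat) (b c : R) (K0 : nat).
Hypothesis fF : forall y, f y = (F y)%:E.
Hypothesis b0 : 0 <= b.
Hypothesis c0 : 0 < c.
Hypothesis decrease : forall k,
  F (x k.+1) + c * enorm (x k.+1 - x k) ^+ 2 <= F (x k).
Hypothesis relative_error : forall k, (K0 <= k)%N ->
  (dist 0 (limiting_subdiff f (x k.+1)) <= (b * enorm (x k.+1 - x k))%:E)%E.
Hypothesis p_ge : forall n, (n <= p n)%N.
Hypothesis cvg_xp : x (p n) @[n --> \oo] --> xs.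
Hypothesis cvg_Fxp : F (x (p n)) @[n --> \oo] --> F xs.

Let a k := enorm (x k - x k.-1).

Lemma descent_nonincreasing m n : (m <= n)%N -> F (x n) <= F (x m).
Proof.
elim: n => [|n IHn]; first by rewrite leqn0 => /eqP->.
rewrite leq_eqVlt => /predU1P[->//|/IHn]; apply: le_trans.
by rewrite (le_trans _ (decrease n))// lerDl mulr_ge0 ?sqr_ge0// ltW.
Qed.

(** By monotonicity, [F (x k)] dominates the values along the subsequence from index k on, hence
    their limit. *)
Lemma descent_lower_bound k : F xs <= F (x k).
Proof.
apply: (cvgr_to_le cvg_Fxp); exists k => // n kn /=.
by apply: descent_nonincreasing; exact: leq_trans (p_ge n).
Qed.

Lemma descent_values_near e : 0 < e -> \forall k \near \oo, F (x k) < F xs + e.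
Proof.
move=> e0; have Fe : F xs < F xs + e by rewrite ltrDl.
have [N _ HN] := cvgr_lt _ cvg_Fxp _ Fe.
exists (p N) => // k /= pNk.
exact: le_lt_trans (descent_nonincreasing pNk) (HN N (leqnn N)).
Qed.

Lemma descent_steps_cvg0 : a k @[k --> \oo] --> (0 : R).
Proof.
apply: (sufficient_decrease_cvg0 c0 _ descent_lower_bound) => [k|].
  exact: enorm_ge0.
exact: decrease.
Qed.

(** Three bounds are multiplied: decrease gives [c * a k.+2 ^+ 2 <= t - s], KL with the relative
    error gives [1 <= derive1 phi t * (b * a k.+1)], and concavity gives
    [derive1 phi t * (t - s) <= phi t - phi s]. *)
Lemma KL_step (phi : R -> R) (eta : \bar R) k :
  desingularizing eta phi -> (K0 <= k)%N -> ((F (x k.+1) - F xs)%:E < eta)%E ->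
  (f xs < f (x k.+1) -> f (x k.+1) < f xs + eta ->
    1 <= (derive1 phi (fine (f (x k.+1) - f xs)))%:E
         * dist 0%R (limiting_subdiff f (x k.+1)))%E ->
  2 * a k.+2 <= a k.+1 +
    b / c * (phi (F (x k.+1) - F xs) - phi (F (x k.+2) - F xs)).
Proof.
move=> [_ cphi _ _ dphi] kK0 t_eta; rewrite !fF lte_fin -lteBlDl//.
have := decrease k.+1; rewrite -/(a k.+2) -EFinB /= => st.
have : 0 <= F (x k.+1) - F xs by rewrite subr_ge0 descent_lower_bound.
have : 0 <= F (x k.+2) - F xs by rewrite subr_ge0 descent_lower_bound.
have {st} : c * a k.+2 ^+ 2 <= (F (x k.+1) - F xs) - (F (x k.+2) - F xs) by lra.
rewrite -[F xs < _]subr_gt0; set t := _ - F xs; set s := _ - F xs => st s0 t0.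
have a2 : 0 <= a k.+2 by exact: enorm_ge0.
have ca2 : 0 <= c * a k.+2 ^+ 2 by rewrite mulr_ge0 ?sqr_ge0// ltW.
have ts0 : 0 <= t - s by exact: le_trans st.
(* If the limit value is already attained, KL says nothing, but the decrease forces the next step to
   vanish. *)
have [tE|tN0] := eqVneq t 0.
  move=> _; have sE : s = 0 by lra.
  rewrite sE tE subrr mulr0 addr0.
  suff -> : a k.+2 = 0 by rewrite mulr0 enorm_ge0.
  have /eqP : c * a k.+2 ^+ 2 = 0 by lra.
  by rewrite mulf_eq0 gt_eqF//= sqrf_eq0 => /eqP.
have {}tN0 : 0 < t by rewrite lt_neqAle eq_sym tN0.
move=> /(_ tN0 t_eta) KL.
have [dphi_t _ phi'_gt0] := dphi t tN0 t_eta.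
have KL1 : 1 <= derive1 phi t * (b * a k.+1).
  rewrite -lee_fin EFinM; apply: le_trans KL _.
  by apply: lee_wpmul2l; [rewrite lee_fin ltW|exact: relative_error].
have tangent : derive1 phi t * (t - s) <= phi t - phi s.
  have [->|sN] := eqVneq s t; first by rewrite !subrr mulr0.
  apply: concave_tangent cphi _ _ _ dphi_t.
  - by split => //; apply: le_lt_trans t_eta; rewrite lee_fin -/t; lra.
  - by split => //; exact: ltW.
  - by rewrite lt_neqAle sN; lra.
have a1 : 0 <= a k.+1 by exact: enorm_ge0.
have ba : 0 <= b * a k.+1.
  by rewrite -(pmulr_rge0 _ phi'_gt0) (le_trans _ KL1).
set m := b / c * _.
have key : a k.+2 ^+ 2 <= a k.+1 * m.
  rewrite -(ler_pM2l c0).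
  have -> : c * (a k.+1 * m) = b * a k.+1 * (phi t - phi s).
    by rewrite /m; field; rewrite gt_eqF.
  apply: le_trans st _; apply: le_trans (ler_wpM2l ba tangent).
  by rewrite mulrA (mulrC (b * _)) ler_peMl.
(* Nonnegativity permits comparing squares; [a k.+1 = 0] would turn [KL1] into [1 <= 0]. *)
have m0 : 0 <= a k.+1 + m.
  have [a10|a1N] := eqVneq (a k.+1) 0.
    by move: KL1; rewrite a10 !mulr0; lra.
  have a1p : 0 < a k.+1 by rewrite lt_neqAle eq_sym a1N.
  by rewrite addr_ge0// -(pmulr_rge0 _ a1p) (le_trans _ key)// sqr_ge0.
rewrite -(ler_pXn2r (n := 2)) ?nnegrE ?mulr_ge0//.
(* AM-GM on a k.+2 ^+ 2 <= a k.+1 * m. *)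
have := sqr_ge0 (a k.+1 - m); rewrite exprMn sqrrB sqrrD; lra.
Qed.

(** With the potential [E k = a k + b / c * Delta k], [KL_step] reads [a k.+1 + E k.+1 <= E k].
    Hence the distance to [xs] plus [E], and the path length plus [E], do not increase while the
    iterates stay in the KL neighborhood, and the first bound keeps them there. *)
Lemma KL_trapping r : KL_at f xs -> 0 < r ->
  exists m B, forall j, enorm (x (m + j)%N - xs) < r /\
    \sum_(1 <= i < (m + j).+1) a i <= B.
Proof.
move=> [eta [U [phi [eta0 Uxs dphi KL]]]] r0.
have [r1 r10 Ur1] := (nbhs_enormP xs U).1 Uxs.
pose rho := Num.min r r1.
have rho0 : 0 < rho by rewrite lt_min r0.
have rho30 : 0 < rho / 3 by rewrite divr_gt0.
have [phi_cont _ phi_ge0 phi00 _] := dphi.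
pose Delta k := phi (F (x k) - F xs).
have eta_near : \forall k \near \oo, ((F (x k) - F xs)%:E < eta)%E.
  case: eta eta0 {KL dphi phi_cont phi_ge0} => [e||]// e0.
    apply: filterS (descent_values_near e0) => k.
    by rewrite lte_fin -ltrBlDl.
  by apply: nearW => k; rewrite ltry.
have Delta_cvg : Delta k @[k --> \oo] --> (0 : R).
  apply/cvgrPdist_lt => e e0.
  (* Continuity of [phi] at 0 is only relative to its domain, so the value gaps must be shown
     nonnegative and below [eta]. *)
  have phi_cvg0 : phi t @[t --> within [set t | 0 <= t /\ (t%:E < eta)%E]
      (nbhs (0 : R))] --> (0 : R).
    rewrite -[X in _ --> X]phi00.
    exact: (subspace_continuousP _ _).1 phi_cont 0 (conj (lexx 0) eta0).
  have /cvgrPdist_lt/(_ e e0)/nbhs_ballP[q /= q0 Hq] := phi_cvg0.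
  apply: filterS2 (descent_values_near q0) eta_near => k Fk etak.
  have Fk0 : 0 <= F (x k) - F xs by rewrite subr_ge0 descent_lower_bound.
  apply: Hq; last by split.
  by rewrite -ball_normE /= sub0r normrN ger0_norm// ltrBlDl.
have Delta_near : \forall k \near \oo, b / c * Delta k < rho / 3.
  have /cvgr_lt : b / c * Delta k @[k --> \oo] --> b / c * 0.
    by apply: cvgM Delta_cvg; exact: cvg_cst.
  by apply; rewrite mulr0.
have a_near : \forall k \near \oo, a k < rho / 3.
  exact: (cvgr_lt _ descent_steps_cvg0).
have [N1 _ HN1] : \forall k \near \oo,
    [/\ ((F (x k) - F xs)%:E < eta)%E, b / c * Delta k < rho / 3,
        a k < rho / 3 & (K0 < k)%N].
  near=> k; split; near: k => //; exact: nbhs_infty_gt.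
have [N2 _ HN2] := (cvg_enormP _ _).1 cvg_xp _ rho30.
(* At m the step, the scaled [Delta] and the distance to [xs] are each below [rho / 3]; since
   [N1 <= m], the bounds of [HN1] hold from m on. *)
pose n := maxn N1 N2; pose m := p n.
have N1m j : (N1 <= m + j)%N.
  by rewrite (leq_trans (leq_maxl N1 N2))// (leq_trans (p_ge n))// leq_addr.
have xm : enorm (x m - xs) < rho / 3 by apply: HN2; rewrite /= leq_maxr.
pose E k := a k + b / c * Delta k.
have E_ge0 j : 0 <= E (m + j)%N.
  have [etaj _ _ _] := HN1 _ (N1m j).
  rewrite addr_ge0 ?enorm_ge0// mulr_ge0 ?divr_ge0 ?(ltW c0)//.
  by apply: phi_ge0; split; rewrite ?subr_ge0 ?descent_lower_bound.
pose T k := \sum_(1 <= i < k.+1) a i.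
have TS k : T k.+1 = T k + a k.+1 by rewrite /T big_nat_recr.
have ball_lt j : enorm (x (m + j)%N - xs) + E (m + j)%N <= enorm (x m - xs) + E m ->
    enorm (x (m + j)%N - xs) < rho.
  have := E_ge0 j; have := HN1 _ (N1m 0%N); rewrite addn0 => -[_ h1 h2 _].
  by have : E m = a m + b / c * Delta m by []; lra.
have trap j : enorm (x (m + j)%N - xs) + E (m + j)%N <= enorm (x m - xs) + E m /\
    T (m + j)%N + E (m + j)%N <= T m + E m.
  elim: j => [|j [IH1 IH2]]; first by rewrite addn0.
  have [etaj _ _ K0j] := HN1 _ (N1m j).
  have := ball_lt _ IH1; rewrite lt_min => /andP[_ /Ur1 Uj].
  (* [KL_step] at index k concerns [x k.+1]; the strict [K0 < m + j] provides a predecessor that is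
     still at least [K0]. *)
  have mj : (m + j)%N = (m + j).-1.+1 by rewrite prednK// (leq_trans _ K0j).
  have := @KL_step phi eta (m + j).-1 dphi.
  rewrite -mj -ltnS -mj => /(_ K0j etaj (KL _ Uj)).
  rewrite addnS TS -/(Delta (m + j)%N) -/(Delta (m + j).+1) => step.
  have := ler_enorm_dist (x (m + j).+1) (x (m + j)%N) xs.
  rewrite -[enorm (x (m + j).+1 - x (m + j)%N)]/(a (m + j).+1).
  by move: IH1 IH2; rewrite /E; split; lra.
exists m, (T m + E m) => j; have [H1 H2] := trap j; split.
  by have := ball_lt _ H1; rewrite lt_min => /andP[].
by rewrite -/(T (m + j)%N) (le_trans _ H2)// lerDl.
Unshelve. all: by end_near. Qed.

Lemma KL_descent_cvg : KL_at f xs -> x @ \oo --> xs.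
Proof.
move=> KLxs; apply/cvg_enormP => e e0.
have [m [B mB]] := KL_trapping KLxs e0.
by exists m => // k /= mk; rewrite -(subnKC mk); exact: (mB _).1.
Qed.

Lemma KL_descent_summable : KL_at f xs ->
  (\sum_(1 <= k <oo) (enorm (x k - x k.-1))%:E < +oo)%E.
Proof.
move=> KLxs; have [m [B mB]] := KL_trapping KLxs ltr01.
apply: le_lt_trans (ltry B); apply: lime_le.
  by apply: is_cvg_nneseries => n _ _; rewrite lee_fin enorm_ge0.
near=> n; rewrite sumEFin lee_fin.
have mn : (m < n)%N by near: n; exact: nbhs_infty_gt.
rewrite -(ltn_predK mn) -(subnKC (n := n.-1) (m := m)) ?(mB _).2//.
by rewrite -ltnS (ltn_predK mn).
Unshelve. all: by end_near. Qed.

End KurdykaLojasiewiczDescent.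

(** * The Bregman proximal iteration *)

Section BregmanIteration.
Context {R : realType} {d : nat}.
Context (f1 f2 g h : 'rV[R]_d -> R) (G1 G2 Gh : 'rV[R]_d -> 'rV[R]_d).
Context (psi ge : 'rV[R]_d -> \bar R) (N0 : set 'rV[R]_d).
Context (L sigma lambda v0 : R) (x xi : nat -> 'rV[R]_d).

Let F y := f1 y - f2 y + g y.
Let a k := enorm (x k - x k.-1).
(** The decrease constant: [lambda^-1 - L] is the Bregman weight left after majorizing [f1], and
    [sigma / 2] converts Bregman distance into squared norm. *)
Let c := (lambda^-1 - L) * (sigma / 2).

Hypothesis psiF : forall y, psi y = (F y)%:E.
Hypothesis geg : forall y, ge y = (g y)%:E.
Hypothesis f1_grad : forall y, gradient_at f1 y (G1 y).
Hypothesis h_grad : forall y, gradient_at h y (Gh y).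
Hypothesis f1_cont : continuous f1.
Hypothesis h_cont : continuous h.
Hypothesis G1_cont : continuous G1.
Hypothesis Gh_cont : continuous Gh.
Hypothesis G_lip : forall B, bounded_set B ->
  lipschitz_in B Gh /\ lipschitz_in B G1.
Hypothesis f2_convex : convex_modulus 0 f2.
Hypothesis h_convex : convex_modulus sigma h.
Hypothesis Lhf1_convex : convex_modulus 0 (fun y => L * h y - f1 y).
Hypothesis g_lsc : lower_semicontinuous ge.
Hypothesis F_level : forall r : R, bounded_set [set y | F y <= r].
Hypothesis F_lower : forall y, v0 <= F y.
Hypothesis N0_open : open N0.
Hypothesis N0_crit : forall y u z, convex_subgradient f2 y u ->
  limiting_subdiff ge y z -> 0 = G1 y - u + z -> N0 y.
Hypothesis f2_grad : forall y, N0 y -> gradient_at f2 y (G2 y).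
Hypothesis G2_lip : locally_lipschitz_in N0 G2.
Hypothesis sigma0 : 0 < sigma.
Hypothesis lambda0 : 0 < lambda.
Hypothesis lambdaL : L < lambda^-1.
Hypothesis xi_sub : forall k, convex_subgradient f2 (x k) (xi k).
Hypothesis x_min : forall k u,
  g (x k.+1) + dotv (G1 (x k) - xi k) (x k.+1 - x k)
    + lambda^-1 * (h (x k.+1) - h (x k) - dotv (Gh (x k)) (x k.+1 - x k))
  <= g u + dotv (G1 (x k) - xi k) (u - x k)
    + lambda^-1 * (h u - h (x k) - dotv (Gh (x k)) (u - x k)).

Let w k := G1 (x k) - xi k - lambda^-1 *: Gh (x k).

Lemma c_gt0 : 0 < c.
Proof. by rewrite mulr_gt0 ?subr_gt0// divr_gt0. Qed.

(** The subproblem is tested at [x k]. Convexity of [L h - f1] majorizes [f1] by its linearization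
    plus L times the Bregman distance, and [xi k] minorizes [f2]. *)
Lemma bregman_sufficient_decrease k :
  F (x k.+1) + c * enorm (x k.+1 - x k) ^+ 2 <= F (x k).
Proof.
have := x_min k (x k); rewrite subrr !dotv0r addr0 !subr0 subrr mulr0 addr0.
have Lhf1_grad : gradient_at (fun y => L * h y - f1 y) (x k)
    (L *: Gh (x k) - G1 (x k)).
  by apply: gradient_atB (f1_grad _); exact: gradient_atZ.
have := convex_gradient_le (x k.+1) Lhf1_convex Lhf1_grad.
have := convex_gradient_le (x k.+1) h_convex (h_grad (x k)).
have := xi_sub k (x k.+1).
rewrite !mul0r addr0 !dotvBl dotvZl /c /F.
set q := enorm _ ^+ 2; set D := h (x k.+1) - h (x k) - _ => Hxi Hh HL Hmin.
have : (lambda^-1 - L) * (sigma / 2 * q) <= (lambda^-1 - L) * D.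
  by rewrite ler_wpM2l ?subr_ge0 ?(ltW lambdaL)// /D; lra.
rewrite /D in Hmin *; move: Hmin Hxi HL; rewrite !mulrBl !mulrBr.
lra.
Qed.

Lemma bregman_iterates_bounded : exists M, forall k, enorm (x k) <= M.
Proof.
have [M HM] := bounded_set_enorm_le (F_level (F (x 0%N))).
exists M => k; apply: HM => /=.
exact: (descent_nonincreasing c_gt0 bregman_sufficient_decrease (leq0n k)).
Qed.

(** The lower bound [v0] is used here, as no cluster point has been identified yet. *)
Lemma bregman_steps_cvg0 : a k @[k --> \oo] --> (0 : R).
Proof.
apply: (sufficient_decrease_cvg0 (v := F \o x) c_gt0) => [k|k|k].
- exact: enorm_ge0.
- exact: F_lower.
- exact: bregman_sufficient_decrease.
Qed.

Lemma bregman_dual_bounded : exists K, forall k, enorm (w k) <= K.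
Proof.
have [M xM] := bregman_iterates_bounded.
have [K1 xiK] := convex_subgradient_bounded M f2_convex.
have bG (G : 'rV[R]_d -> 'rV[R]_d) :
    (forall B, bounded_set B -> lipschitz_in B G) ->
    exists K, forall k, enorm (G (x k)) <= K.
  move=> /(_ [set y | enorm y <= M]) GL.
  have [|K GK] := GL; first exact: (bounded_set_enorm (M := M)).
  (* A constant in [lipschitz_in] may be negative, hence the absolute value. *)
  exists (`|K| * (M + M) + enorm (G (x 0%N))) => k.
  rewrite -(subrK (G (x 0%N)) (G (x k))) (le_trans (ler_enormD _ _))// lerD2r.
  rewrite (le_trans (GK _ _ (xM k) (xM 0%N)))//.
  rewrite (le_trans (ler_wpM2r (enorm_ge0 _) (ler_norm K)))// ler_wpM2l//.
  by rewrite (le_trans (ler_enormB _ _))// lerD.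
have [K2 G1K] := bG G1 (fun B bB => (G_lip bB).2).
have [K3 GhK] := bG Gh (fun B bB => (G_lip bB).1).
exists (K2 + K1 + lambda^-1 * K3) => k.
rewrite (le_trans (ler_enormB _ _))// lerD//.
  by rewrite (le_trans (ler_enormB _ _))// lerD// (xiK (x k)).  
by rewrite enormZ gtr0_norm ?invr_gt0// ler_wpM2l// invr_ge0 ltW.
Qed.

(* x_min with the terms independent of u dropped and w k as the slope. *)
Lemma bregman_min k u :
  g (x k.+1) + dotv (w k) (x k.+1) + lambda^-1 * h (x k.+1)
  <= g u + dotv (w k) u + lambda^-1 * h u.
Proof.
have := x_min k u; rewrite /w !(dotvBr, dotvBl, dotvZl).
lra.
Qed.

(** Fermat's rule: the differentiable part of the minimized function moves to the other side with
    opposite gradient. *)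
Lemma bregman_prox_subgradient k :
  regular_subgradient g (x k.+1) (- w k - lambda^-1 *: Gh (x k.+1)).
Proof.
move=> e e0; have le0 : 0 < lambda * e by rewrite mulr_gt0.
apply: filterS (h_grad (x k.+1) le0) => u; rewrite ler_norml => /andP[_ Hu].
have := bregman_min k u; rewrite (dotvBl (- w k)) dotvNl dotvZl dotvBr.
have l0 : 0 <= lambda^-1 by rewrite invr_ge0 ltW.
have := ler_wpM2l l0 Hu; rewrite !mulrA mulVf ?gt_eqF// mul1r.
rewrite !mulrBr; lra.
Qed.

(** * Cluster points of the iterates *)

Section ClusterPoint.
Context (p : nat -> nat) (xs : 'rV[R]_d).
Hypothesis p_ge : forall n, (n <= p n)%N.
Hypothesis cvg_xp : x (p n).+1 @[n --> \oo] --> xs.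

(** The subgradients of [f2] live at [x k] and those of [g] at [x k.+1]; vanishing steps give both
    the same limit. *)
Lemma cluster_previous : x (p n) @[n --> \oo] --> xs.
Proof.
have a_p : a (p n).+1 @[n --> \oo] --> (0 : R).
  have pS_ge n : (n <= (p n).+1)%N by rewrite leqW.
  exact: (cvg_comp _ _ (cvg_infty_ge pS_ge) bregman_steps_cvg0).
apply/cvg_enorm0P.
have /cvg_enorm0P xpS := cvg_xp.
apply: (@squeeze_cvgr _ _ _ _ (fun=> 0)
    (fun n => a (p n).+1 + enorm (x (p n).+1 - xs))).
- apply: nearW => n; rewrite enorm_ge0 /a /=.
  by rewrite (enormB (x (p n).+1) (x (p n))) ler_enorm_dist.
- exact: cvg_cst.
- by rewrite -[X in _ --> X]addr0; exact: cvgD.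
Qed.

(** Lower semicontinuity gives only the lower bound. The upper one comes from minimality tested at
    [xs], with error [r n] controlled by the bound on [w]. *)
Lemma cluster_g_cvg : g (x (p n).+1) @[n --> \oo] --> g xs.
Proof.
have [K wK] := bregman_dual_bounded.
pose r n := K * enorm (x (p n).+1 - xs) + lambda^-1 * (h xs - h (x (p n).+1)).
have r0 : r n @[n --> \oo] --> (0 : R).
  have -> : (0 : R) = K * 0 + lambda^-1 * (h xs - h xs).
    by rewrite subrr !mulr0 addr0.
  apply: cvgD; apply: cvgM; [exact: cvg_cst| |exact: cvg_cst|].
    exact: (cvg_enorm0P _ _).1.
  by apply: cvgB; [exact: cvg_cst|exact: (continuous_cvg _ (@h_cont xs) cvg_xp)].
have g_le n : g (x (p n).+1) <= g xs + r n.
  have := bregman_min (p n) xs.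
  have := le_trans (ler_norm _) (normr_dotv_le (w (p n)) (xs - x (p n).+1)).
  have := ler_wpM2r (enorm_ge0 (x (p n).+1 - xs)) (wK (p n)).
  by rewrite /r dotvBr mulrBr (enormB xs); lra.
apply/cvgrPdist_lt => e e0.
have ge_e : ((g xs - e)%:E < ge xs)%E by rewrite geg lte_fin ltrBlDr ltrDl.
have [V xsV HV] := g_lsc ge_e.
have re : \forall n \near \oo, r n < e by exact: (cvgr_lt _ r0).
near=> n.
have : r n < e by near: n.
have : V (x (p n).+1) by near: n; exact: cvg_xp.
move=> /HV; rewrite geg lte_fin; have := g_le n.
by move=> *; rewrite ltr_norml; apply/andP; split; lra.
Unshelve. all: by end_near. Qed.

Lemma cluster_F_cvg : F (x (p n).+1) @[n --> \oo] --> F xs.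
Proof.
apply: cvgD cluster_g_cvg; apply: cvgB.
  exact: (continuous_cvg _ (@f1_cont xs) cvg_xp).
exact: (continuous_cvg _ (@convex_continuous _ _ _ f2_convex xs) cvg_xp).
Qed.

End ClusterPoint.

(** Along a further subsequence [w] converges, and with it [xi] and the prox subgradients of [g].
    Both kinds of subgradient pass to the limit, and the limits cancel against [G1 xs]. *)
Lemma cluster_critical p xs : (forall n, (n <= p n)%N) ->
  x (p n).+1 @[n --> \oo] --> xs -> N0 xs.
Proof.
move=> p_ge cvg_xp.
have [K wK] := bregman_dual_bounded.
have [q [ws [q_ge cvg_w]]] := bounded_cvg_subsequence (fun n => wK (p n)).
have cvg_xq : x (p (q n)).+1 @[n --> \oo] --> xs.
  exact: (cvg_comp _ _ (cvg_infty_ge q_ge) cvg_xp).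
have pq_ge n : (n <= p (q n))%N by rewrite (leq_trans (q_ge n)).
have cvg_xq' := cluster_previous pq_ge cvg_xq.
have cvg_xi : xi (p (q n)) @[n --> \oo] --> G1 xs - lambda^-1 *: Gh xs - ws.
  have -> : (fun n => xi (p (q n))) = (fun n =>
      G1 (x (p (q n))) - lambda^-1 *: Gh (x (p (q n))) - w (p (q n))).
    by apply/funext => n; rewrite /w !opprB addrA subrK addrC subrK.
  apply: cvgB cvg_w; apply: cvgB.
    exact: (continuous_cvg _ (@G1_cont xs) cvg_xq').
  by apply: cvgZr; exact: (continuous_cvg _ (@Gh_cont xs) cvg_xq').
apply: (@N0_crit xs (G1 xs - lambda^-1 *: Gh xs - ws) (- ws - lambda^-1 *: Gh xs)).
- move=> y.
  have f2xs : f2 (x (p (q n))) @[n --> \oo] --> f2 xs.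
    exact: (continuous_cvg _ (@convex_continuous _ _ _ f2_convex xs) cvg_xq').
  have f2_lim : f2 (x (p (q n))) + dotv (xi (p (q n))) (y - x (p (q n)))
      @[n --> \oo] --> f2 xs + dotv (G1 xs - lambda^-1 *: Gh xs - ws) (y - xs).
    apply: cvgD; [exact: f2xs|apply: cvg_dotv cvg_xi _].
    by apply: cvgB => //; exact: cvg_cst.
  apply: (cvgr_to_le f2_lim).
  by apply: nearW => n; exact: xi_sub.
- split; first by rewrite /dom /= geg ltry.
  exists (fun n => x (p (q n)).+1),
    (fun n => - w (p (q n)) - lambda^-1 *: Gh (x (p (q n)).+1)); split => //.
  + under eq_fun do rewrite geg.
    by rewrite geg; apply: cvg_EFin; [exact: nearW|exact: cluster_g_cvg].
  + apply: cvgB; first exact: cvgN.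
    by apply: cvgZr; exact: (continuous_cvg _ (@Gh_cont xs) cvg_xq).
  + move=> n; exact: (regular_subdiff_intro geg (@bregman_prox_subgradient (p (q n)))).
- by apply/rowP => i; rewrite !mxE; ring.
Qed.

(** A compactness argument by contradiction: violations accumulate at a point that
    [cluster_critical] puts in [N0], where [G2] is Lipschitz nearby. *)
Lemma bregman_eventually_regular : exists K K0, forall k, (K0 <= k)%N ->
  [/\ N0 (x k), N0 (x k.+1) &
      enorm (G2 (x k.+1) - G2 (x k)) <= K * enorm (x k.+1 - x k)].
Proof.
have [M xM] := bregman_iterates_bounded.
apply: contrapT => notK.
(* Here n is both the index threshold and the Lipschitz constant that fails, so it eventually
   exceeds the local constant. *)
have /choice[q Hq] : forall n, exists k, (n <= k)%N /\ ~ [/\ N0 (x k), N0 (x k.+1) &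
    enorm (G2 (x k.+1) - G2 (x k)) <= n%:R * enorm (x k.+1 - x k)].
  move=> n; apply: contrapT => notk; apply: notK; exists n%:R, n => k nk.
  by apply: contrapT => Hk; apply: notk; exists k.
have [r [xs [r_ge cvg_xq]]] :=
  bounded_cvg_subsequence (u := fun n => x (q n).+1) (fun n => xM _).
have qr_ge n : (n <= q (r n))%N by rewrite (leq_trans (r_ge n))// (Hq _).1.
have cvg_xq' := cluster_previous qr_ge cvg_xq.
have N0xs := cluster_critical qr_ge cvg_xq.
have nbhsN0 : nbhs xs N0 by exact: open_nbhs_nbhs.
have [U nbhsU [K UK]] := G2_lip N0xs.
near \oo => n.
have N0q : N0 (x (q (r n))) by near: n; exact: cvg_xq'.
have Uq : U (x (q (r n))) by near: n; exact: cvg_xq'.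
have N0qS : N0 (x (q (r n)).+1) by near: n; exact: cvg_xq.
have UqS : U (x (q (r n)).+1) by near: n; exact: cvg_xq.
case: (Hq (r n)) => _; apply; split => //.
apply: le_trans (UK _ _ _ _) _; [by []|by []|].
rewrite ler_wpM2r ?enorm_ge0//.
have : K <= n%:R by near: n; exact: nbhs_infty_ger.
by move=> /le_trans; apply; rewrite ler_nat.
Unshelve. all: by end_near. Qed.

(* The residual below cancels the prox subgradient's xi k against the gradient
   of f2 at x k, leaving only increments of the three gradients. *)
Lemma bregman_relative_error : exists b K0, 0 <= b /\
  forall k, (K0 <= k)%N -> exists2 z, regular_subdiff psi (x k.+1) z &
    enorm z <= b * enorm (x k.+1 - x k).
Proof.
have [M xM] := bregman_iterates_bounded.
have [K [K0 HK]] := bregman_eventually_regular.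
have bB : bounded_set [set y : 'rV[R]_d | enorm y <= M].
  exact: (bounded_set_enorm (M := M)).
have [[Kh HKh] [K1 HK1]] := G_lip bB.
exists (`|K1| + `|K| + lambda^-1 * `|Kh|), K0; split.
  by rewrite !addr_ge0// mulr_ge0// invr_ge0 ltW.
move=> k /HK[N0k N0k1 G2k].
have xiE : xi k = G2 (x k).
  exact: gradient_at_subgradient (f2_grad N0k) (xi_sub k).
pose z := (- w k - lambda^-1 *: Gh (x k.+1)) + (G1 (x k.+1) - G2 (x k.+1)).
exists z.
  apply: (regular_subdiff_intro (F := fun y => g y + (f1 y - f2 y))).
    by move=> y; rewrite psiF /F addrC.
  apply: regular_subgradientD; first exact: bregman_prox_subgradient.
  exact: gradient_atB (f1_grad _) (f2_grad N0k1).
have -> : z = (G1 (x k.+1) - G1 (x k)) - (G2 (x k.+1) - G2 (x k))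
    - lambda^-1 *: (Gh (x k.+1) - Gh (x k)).
  rewrite /z /w xiE scalerBr.
  apply/rowP => i; rewrite !mxE; ring.
set u := enorm (x k.+1 - x k); have u0 : 0 <= u by exact: enorm_ge0.
rewrite (le_trans (ler_enormB _ _))// mulrDl lerD//.
  rewrite (le_trans (ler_enormB _ _))// mulrDl lerD//.
    by rewrite (le_trans (HK1 _ _ (xM _) (xM _)))// ler_wpM2r// ler_norm.
  by rewrite (le_trans G2k)// ler_wpM2r// ler_norm.
rewrite enormZ gtr0_norm ?invr_gt0// -mulrA ler_wpM2l ?invr_ge0 ?(ltW lambda0)//.
by rewrite (le_trans (HKh _ _ (xM _) (xM _)))// ler_wpM2r// ler_norm.
Qed.

Lemma bregman_dist_cvg0 :
  dist 0 (limiting_subdiff psi (x k)) @[k --> \oo] --> 0%E.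
Proof.
have [b [K0 [b0 Hb]]] := bregman_relative_error.
have ba0 : (b * a k)%:E @[k --> \oo] --> 0%E.
  apply: cvg_EFin; first exact: nearW.
  rewrite -(mulr0 b); apply: cvgM bregman_steps_cvg0; exact: cvg_cst.
apply: (squeeze_cvge _ (cvg_cst 0%E) ba0).
exists K0.+1 => // -[//|k] /= /Hb[z psiz zb].
rewrite dist0_ge0 (le_trans (dist0_le (regular_limiting_subdiff psiz)))//.
Qed.

Lemma bregman_cvg : KL_function psi ->
  dist 0 (limiting_subdiff psi (x k)) @[k --> \oo] --> 0%E /\
  (exists2 xs, x @ \oo --> xs & limiting_subdiff psi xs 0) /\
  (\sum_(1 <= k <oo) (enorm (x k - x k.-1))%:E < +oo)%E.
Proof.
move=> KLpsi; split; first exact: bregman_dist_cvg0.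
have [b [K0 [b0 Hb]]] := bregman_relative_error.
have [M xM] := bregman_iterates_bounded.
(* Shifting by [K0] puts every selected index in the range of the relative error bound. *)
have [p [xs [p_ge cvg_xp]]] :=
  bounded_cvg_subsequence (u := fun n => x (n + K0)%N.+1) (fun n => xM _).
pose q n := (p n + K0)%N.
have q_ge n : (n <= q n)%N by rewrite (leq_trans (p_ge n))// leq_addr.
have qK0 n : (K0 <= q n)%N by rewrite leq_addl.
have cvg_xq : x (q n).+1 @[n --> \oo] --> xs by [].
have cvg_Fxq := cluster_F_cvg cvg_xq.
have /choice[z Hz] : forall n, exists z, regular_subdiff psi (x (q n).+1) z /\
    enorm z <= b * a (q n).+1.
  by move=> n; have [z] := Hb _ (qK0 n); exists z.
have qS_ge n : (n <= (q n).+1)%N by rewrite leqW.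
have z0 : z n @[n --> \oo] --> (0 : 'rV[R]_d).
  have ba0 : b * a (q n).+1 @[n --> \oo] --> (0 : R).
    rewrite -(mulr0 b); apply: cvgM; first exact: cvg_cst.
    exact: (cvg_comp _ _ (cvg_infty_ge qS_ge) bregman_steps_cvg0).
  apply/cvg_enorm0P; apply: (squeeze_cvgr _ (cvg_cst 0) ba0).
  by apply: nearW => n; rewrite subr0 enorm_ge0 (Hz n).2.
have xs_stat : limiting_subdiff psi xs 0.
  split; first by rewrite /dom /= psiF ltry.
  exists (fun n => x (q n).+1), z; split => //.
    under eq_fun do rewrite psiF.
    by rewrite psiF; apply: cvg_EFin; [exact: nearW|exact: cvg_Fxq].
  by move=> n; exact: (Hz n).1.
(* Stationarity of [xs] places it in [dom_subdiff psi], where the KL property is available. *)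
have KLxs : KL_at psi xs by apply: KLpsi; exists 0.
have err k : (K0 <= k)%N ->
    (dist 0 (limiting_subdiff psi (x k.+1)) <= (b * enorm (x k.+1 - x k))%:E)%E.
  move=> /Hb[v psiv vb].
  by rewrite (le_trans (dist0_le (regular_limiting_subdiff psiv)))// lee_fin.
split.
  exists xs => //.
  exact: (KL_descent_cvg psiF b0 c_gt0 bregman_sufficient_decrease err qS_ge
    cvg_xq cvg_Fxq).
exact: (KL_descent_summable psiF b0 c_gt0 bregman_sufficient_decrease err qS_ge
  cvg_xq cvg_Fxq).
Qed.

End BregmanIteration.

(** * Finite extended-real functions *)

Section FiniteFunctions.
Context {R : realType} {d : nat} (f : 'rV[R]_d -> \bar R).
Hypothesis f_fin : forall y, f y \is a fin_num.

Lemma strongly_convex_modulus s :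
  strongly_convex s f -> convex_modulus s (fun y => fine (f y)).
Proof.
move=> cf x y t t01; have := cf x y t t01.
by rewrite -(fineK (f_fin _)) -(fineK (f_fin x)) -(fineK (f_fin y)) -!EFinM
  -!EFinD lee_fin.
Qed.

Lemma econvex_modulus : econvex f -> convex_modulus 0 (fun y => fine (f y)).
Proof.
move=> cf; apply: strongly_convex_modulus => x y t t01.
by rewrite !mul0r adde0; exact: cf.
Qed.

Lemma csubdiff_subgradient x xi :
  csubdiff f x xi <-> convex_subgradient (fun y => fine (f y)) x xi.
Proof.
suff E y : (0 <= f y - f x - (dotv xi (y - x))%:E)%E =
    (fine (f x) + dotv xi (y - x) <= fine (f y)).
  by split=> fxi y; have := fxi y; rewrite E.
rewrite -(fineK (f_fin y)) -(fineK (f_fin x)) -!EFinB lee_fin subr_ge0.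
by rewrite lerBrDl.
Qed.

Lemma C1_on_gradient A x : C1_on A f -> A x ->
  gradient_at (fun y => fine (f y)) x (grad f x).
Proof. by move=> fC1 /fC1[_ df _]; exact: differentiable_gradient_at. Qed.

Lemma C1_on_continuous : C1_on setT f ->
  continuous (fun y => fine (f y)) /\ continuous (grad f).
Proof.
move=> fC1; split=> x; have [//|_ df gradf] := fC1 x; last exact: gradf.
exact: differentiable_continuous.
Qed.

End FiniteFunctions.

Theorem theorem2 (R : realType) (d : nat) (C : set 'rV[R]_d)
    (f1 f2 g h : 'rV[R]_d -> \bar R) (L sigma lambda : R)
    (N0 : set 'rV[R]_d) (x : nat -> 'rV[R]_d)
    (hC0 : C !=set0) (hCconv : convex_set C) (hCopen : open C)
    (hbasic : basic_assumptions C f1 f2 g h)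
    (hL : 0 < L) (hsmad : smad L C f1 h)
    (hprox : forall (y xi : 'rV[R]_d) (lambda' : R),
       C y -> csubdiff f2 y xi -> 0 < lambda' ->
       bregman_prox C f1 g h lambda' y xi `<=` C)
    (hdomh : dom h = setT) (hsigma : 0 < sigma)
    (hstrong : strongly_convex sigma h)
    (hlip : forall B : set 'rV[R]_d, bounded_set B ->
       lipschitz_in B (grad h) /\ lipschitz_in B (grad f1))
    (hlevel : level_bounded (Psi f1 f2 g))
    (hN0 : open N0) (hcrit : limiting_critical f1 f2 g `<=` N0)
    (hf2 : C1_on N0 f2) (hf2lip : locally_lipschitz_in N0 (grad f2))
    (hKL : KL_function (Psi f1 f2 g))
    (hlambda : 0 < lambda * L < 1)
    (hx : BPDCA C f1 f2 g h lambda x) :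
  dist 0 (limiting_subdiff (Psi f1 f2 g) (x k)) @[k --> \oo] --> 0%E /\
  (exists2 xt : 'rV[R]_d, x @ \oo --> xt & limiting_stationary f1 f2 g xt) /\
  (\sum_(1 <= k <oo) (enorm (x k - x k.-1))%:E < +oo)%E.
Proof.
have CT : C = setT by rewrite -(kg_int_dom (ba_kernel hbasic)) hdomh interiorT.
subst C.
have C1h := kg_C1 (ba_kernel hbasic); have C1f1 := ba_f1_C1 hbasic.
have h_fin y : h y \is a fin_num by have [] := C1h y.
have f1_fin y : f1 y \is a fin_num by have [] := C1f1 y.
(* Finiteness comes from the inclusion of [dom h], the whole space, in the domain of [f1 + g]. *)
have g_fin y : g y \is a fin_num.
  have g_proper : g y != -oo%E by have [] := ba_g_proper hbasic.
  have : dom (fun x => f1 x + g x)%E y.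
    by apply: ba_f1g_dom hbasic _ _; rewrite hdomh.
  rewrite /dom /= -(fineK (f1_fin y)).
  by case: (g y) g_proper.
have opt_le y : (optimal_value setT f1 f2 g <= Psi f1 f2 g y)%E.
  by apply: ereal_inf_lbound; exists y => //; exact: subset_closure.
have opt := ba_bounded hbasic.
(* If [f2 y] were infinite, [Psi] would be [-oo] at y, against the finite lower bound. *)
have f2_fin y : f2 y \is a fin_num.
  have f2_proper : f2 y != -oo%E by have [] := ba_f2_proper hbasic.
  have := lt_le_trans opt (opt_le y); rewrite /Psi -(fineK (f1_fin y)).
  by case: (f2 y) f2_proper.
have psiE y : Psi f1 f2 g y = (fine (f1 y) - fine (f2 y) + fine (g y))%:E.
  by rewrite EFinD EFinB !fineK.
have [v0 Hv0] : exists v0, forall y, v0 <= fine (f1 y) - fine (f2 y) + fine (g y).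
  (* The value [+oo] is excluded by the finite value of [Psi] at 0. *)
  case: (optimal_value _ _ _ _) opt opt_le => [v||]// _ opt_le.
    by exists v => y; rewrite -lee_fin -psiE.
  by have := opt_le 0; rewrite psiE.
case: hx => _ [xi Hxi].
have xi_sub k : convex_subgradient (fun y => fine (f2 y)) (x k) (xi k).
  by apply/(csubdiff_subgradient f2_fin); exact: (Hxi k).1.
have gE y : g y = (fine (g y))%:E by rewrite fineK.
have [f1_cont G1_cont] := C1_on_continuous C1f1.
have [h_cont Gh_cont] := C1_on_continuous C1h.
have lambda0 : 0 < lambda by case/andP: hlambda => lL _; rewrite -(pmulr_lgt0 _ hL).
have lambdaL : L < lambda^-1.
  by case/andP: hlambda => _ lL; rewrite -[_^-1]mul1r ltr_pdivlMr// mulrC.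
have x_min k u :
    fine (g (x k.+1)) + dotv (grad f1 (x k) - xi k) (x k.+1 - x k)
      + lambda^-1 * (fine (h (x k.+1)) - fine (h (x k))
          - dotv (grad h (x k)) (x k.+1 - x k))
    <= fine (g u) + dotv (grad f1 (x k) - xi k) (u - x k)
      + lambda^-1 * (fine (h u) - fine (h (x k)) - dotv (grad h (x k)) (u - x k)).
  have [_ [_ /(_ u)]] := Hxi k; rewrite closureT => /(_ I).
  rewrite /subproblem /bregman -(fineK (g_fin u)) -(fineK (g_fin (x k.+1))).
  rewrite -(fineK (h_fin u)) -(fineK (h_fin (x k.+1))) -(fineK (h_fin (x k))).
  by rewrite -!EFinB -!EFinM -!EFinD lee_fin.
have level r : bounded_set [set y | fine (f1 y) - fine (f2 y) + fine (g y) <= r].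
  have := hlevel r; congr bounded_set; apply/funext => y.
  by rewrite /= psiE lee_fin.
have crit y u z : convex_subgradient (fun y => fine (f2 y)) y u ->
    limiting_subdiff g y z -> 0 = grad f1 y - u + z -> N0 y.
  move=> f2u gz yuz; apply: hcrit; exists u, z; split => //.
  exact/(csubdiff_subgradient f2_fin).
have smad_sub0 : convex_modulus 0 (fun y => L * fine (h y) - fine (f1 y)).
  apply/convex_modulus0 => y z t.
  exact: (convex_functionW (smad_sub hsmad)).
have f2_grad y (N0y : N0 y) := C1_on_gradient hf2 N0y.
have f1_grad y := C1_on_gradient C1f1 (I : setT y).
have h_grad y := C1_on_gradient C1h (I : setT y).
have f2_convex := econvex_modulus f2_fin (ba_f2_convex hbasic).
have h_convex := strongly_convex_modulus h_fin hstrong.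
exact: (bregman_cvg psiE gE f1_grad h_grad f1_cont h_cont G1_cont
    Gh_cont hlip f2_convex h_convex smad_sub0 (ba_g_lsc hbasic) level Hv0 hN0
    crit f2_grad hf2lip hsigma lambda0 lambdaL xi_sub x_min).
Qed.
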